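(* Let $q$ be a prime power, let $m\ge1$, $s\ge1$, $u\ge0$ and $r\ge1$ be integers, and let $\mathbf{e}=(e_1,\dots,e_s)\in\mathbb{N}^s$. If there exists a digital $(u,m,\mathbf{e},s)$-net over $\mathbb{F}_{q^r}$, then there exists a digital $((r-1)m+u,\,rm,\,\mathbf{f},\,rs)$-net over $\mathbb{F}_q$, where $\mathbf{f}=(e_1,\dots,e_1,e_2,\dots,e_2,\dots,e_s,\dots,e_s)\in\mathbb{N}^{rs}$ with each $e_i$ repeated $r$ times.
   Context: $\mathbb{N}$ denotes the positive integers, $\lambda_s$ Lebesgue measure. An elementary interval in base $b$ is $J=\prod_{i=1}^s[a_ib^{-d_i},(a_i+1)b^{-d_i})$ with integers $d_i\ge0$, $0\le a_i<b^{d_i}$. For integers $0\le u\le m$ and $\mathbf{e}=(e_1,\dots,e_s)\in\mathbb{N}^s$, a set of $b^m$ points in $[0,1)^s$ is a $(u,m,\mathbf{e},s)$-net in base $b$ if every elementary interval $J$ in base $b$ with $\lambda_s(J)\ge b^{u-m}$ and $e_i\mid d_i$ for all $i$ contains exactly $b^m\lambda_s(J)$ of the points. Digital net over a finite field $\mathbb{F}_Q$ ($Q$ a prime power): given $m\times m$ generating matrices $C_1,\dots,C_s$ over $\mathbb{F}_Q$, bijections $\eta_r:Z_Q\to\mathbb{F}_Q$ ($0\le r<m$) and $\kappa_{i,j}:\mathbb{F}_Q\to Z_Q$ where $Z_Q=\{0,\dots,Q-1\}$, for $0\le n<Q^m$ with base-$Q$ digits $n_0,\dots,n_{m-1}$ put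 $(y^{(i)}_{n,1},\dots,y^{(i)}_{n,m})^\top=C_i(\eta_0(n_0),\dots,\eta_{m-1}(n_{m-1}))^\top$, $x_n^{(i)}=\sum_{j=1}^m\kappa_{i,j}(y^{(i)}_{n,j})Q^{-j}$, $\mathbf{x}_n=(x_n^{(1)},\dots,x_n^{(s)})$. The resulting point set is a digital net over $\mathbb{F}_Q$; it is a digital $(u,m,\mathbf{e},s)$-net over $\mathbb{F}_Q$ if it is a $(u,m,\mathbf{e},s)$-net in base $Q$. *)

(* Defs.v *)
From HB Require Import structures.
From mathcomp Require Import all_boot all_order all_algebra.
From mathcomp Require Import all_classical all_reals all_analysis.

Set Implicit Arguments.
Unset Strict Implicit.
Unset Printing Implicit Defensive.

Import Order.TTheory GRing.Theory Num.Theory.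
Import numFieldNormedType.Exports.

Local Open Scope classical_set_scope.
Local Open Scope ring_scope.

(* s-dimensional Lebesgue measure on R^s = s.-tuple R, as the iterated product
   of the library's one-dimensional one: as in the library's [product_measure1],
   the measure of A is the integral of the measures of its sections.  On R^0 it
   is the unit mass.  It is the usual measure for Borel A; the elementary
   intervals below are Borel. *)
Fixpoint lebesgueN (R : realType) (s : nat) : set (s.-tuple R) -> \bar R :=
  match s with
  | 0 => fun A => \d_([tuple]) A
  | s'.+1 => fun A => (\int[lebesgue_measure]_(x in setT)
                         lebesgueN [set t : s'.-tuple R | A [tuple of x :: t]])%E
  end.

Definition elementary_interval (R : realType) (b s : nat) (d a : 'I_s -> nat) :
    set (s.-tuple R) :=
  [set x | forall i, (a i)%:R / (b ^ d i)%:R <= tnth x i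
                       < (a i).+1%:R / (b ^ d i)%:R].

(* Point sets are indexed families, so that points are counted with
   multiplicity. *)
Definition is_net (R : realType) (b u m s : nat) (e : 'I_s -> nat)
    (P : 'I_(b ^ m) -> s.-tuple R) : Prop :=
  [/\ (u <= m)%N,
      forall n i, 0 <= tnth (P n) i < 1 &
      forall d a : 'I_s -> nat,
        (forall i, (a i < b ^ d i)%N) ->
        (forall i, (e i %| d i)%N) ->
        let J := @elementary_interval R b s d a in
        ((b%:R ^ (u%:Z - m%:Z))%:E <= lebesgueN J)%E ->
        (#|[pred n | P n \in J]|%:R%:E = (b ^ m)%:R%:E * lebesgueN J)%E].

Lemma card_finField_gt0 (F : finFieldType) : (0 < #|F|)%N.
Proof. exact: ltnW (card_finNzRing_gt1 F). Qed.

Definition digit (Q : nat) (Q_gt0 : (0 < Q)%N) (n k : nat) : 'I_Q :=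
  Ordinal (ltn_pmod (n %/ Q ^ k) Q_gt0).

Record digital_generator (F : finFieldType) (m s : nat) := DigitalGenerator {
  gen_mx : 'I_s -> 'M[F]_m;
  gen_eta : 'I_m -> 'I_#|F| -> F;
  gen_kappa : 'I_s -> 'I_m -> F -> 'I_#|F|;
  gen_eta_bij : forall k, bijective (gen_eta k);
  gen_kappa_bij : forall i j, bijective (gen_kappa i j)
}.

Definition digital_output (F : finFieldType) (m s : nat)
    (D : digital_generator F m s) (n : nat) (i : 'I_s) : 'cV[F]_m :=
  gen_mx D i *m \col_k gen_eta D k (digit (card_finField_gt0 F) n k).

(* The index j : 'I_m starts at 0, whence the exponent j.+1. *)
Definition digital_points (R : realType) (F : finFieldType) (m s : nat)
    (D : digital_generator F m s) (n : 'I_(#|F| ^ m)) : s.-tuple R :=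
  [tuple \sum_(j < m) (gen_kappa D i j (digital_output D n i j ord0))%:R
                        / (#|F| ^ j.+1)%:R | i < s].

Definition digital_net_exists (R : realType) (F : finFieldType) (u m s : nat)
    (e : 'I_s -> nat) : Prop :=
  exists D : digital_generator F m s, is_net u e (@digital_points R F m s D).

Lemma block_index_lt (r s : nat) (k : 'I_(r * s)) : (k %/ r < s)%N.
Proof.
case: r k => [|r] [k /= k_lt]; first by rewrite mul0n in k_lt.
by rewrite ltn_divLR // mulnC.
Qed.

(* (e_1, ..., e_1, ..., e_s, ..., e_s), each entry repeated r times. *)
Definition repeat_each (r s : nat) (e : 'I_s -> nat) : 'I_(r * s) -> nat :=
  fun k => e (Ordinal (block_index_lt k)).

(* Main.v *)
(** A box with [e_i | d_i] and volume at least [Q^(u - m)] prescribes the first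
[d_i] output digits in each coordinate [i], so the net property says that the
system made of the first [d_i] rows of each [C_i] is solvable for every
right-hand side: all fibres of a surjective linear map have the same size.
Fix an [F_q]-basis of [F_(q^r)], replace the [j]-th row of [C_i], [j <= m], by
its [r] coordinate forms, one for each of the [r] new matrices, and fill the
remaining rows with zeros.  If [D_i] is the maximum of the [r] exponents
[d_(i,l)], then [e_i | D_i] and [sum_i D_i <= sum_(i,l) d_(i,l) <= m - u], so
the first [D_i] rows of the [C_i] form a solvable system over [F_(q^r)], hence
the system over [F_q] is solvable as well. *)

From HB Require Import structures.
Require Import Defs.
From mathcomp Require Import all_boot all_order all_algebra.
From mathcomp Require Import all_fingroup all_solvable all_field.
From mathcomp Require Import all_classical all_reals all_analysis.

Set Implicit Arguments.
Unset Strict Implicit.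
Unset Printing Implicit Defensive.

Import Order.TTheory GRing.Theory Num.Theory.

Local Open Scope classical_set_scope.
Local Open Scope ring_scope.

(** * Embeddings and coordinates of finite fields *)

Lemma finField_primitive (F : finFieldType) :
  exists w : F, forall x, x != 0 -> exists k, x = w ^+ k.
Proof.
have /cyclicP [g genG] := field_unit_group_cyclic [set: {unit F}].
exists (val g) => x x0.
have ux : x \is a GRing.unit by rewrite unitfE.
have /cycleP [k xk] : FinRing.Unit ux \in <[g]>%g by rewrite -genG inE.
by exists k; rewrite -FinRing.val_unitX -xk.
Qed.

(** Monomials suffice, since every nonzero element is a power of a primitive element [w]; so [w]
    generates [L] over the image of any field. *)
Lemma horner_primitive_surj (K : fieldType) (L : finFieldType)
    (f : {rmorphism K -> L}) :
  exists w : L, forall x, exists A : {poly K}, x = (map_poly f A).[w].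
Proof.
have [w wP] := finField_primitive L; exists w => x.
have [->|/wP [k ->]] := eqVneq x 0; first by exists 0; rewrite rmorph0 horner0.
by exists 'X^k; rewrite map_polyXn hornerXn.
Qed.

(** [P] is a minimal polynomial of [w] up to a scalar, taken of least size among the nonzero
    annihilators. Reduction modulo [P] keeps the value at [w], so a nonzero remainder would be a
    smaller annihilator. *)
Lemma annihilator_generator (K L : fieldType) (f : {rmorphism K -> L}) (w : L)
    (A0 : {poly K}) :
  A0 != 0 -> root (map_poly f A0) w ->
  exists2 P : {poly K}, P != 0 &
    forall A, root (map_poly f A) w = (P %| A).
Proof.
move=> A0n rA0.
pose kills n :=
  `[< exists A : {poly K}, [/\ A != 0, root (map_poly f A) w & size A = n] >].
have /ex_minnP [n /asboolP [P [P0 rP sP]] n_min] : exists n, kills n.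
  by exists (size A0); apply/asboolP; exists A0.
exists P => // A.
have -> : root (map_poly f A) w = root (map_poly f (A %% P)) w.
  rewrite /root {1}(divp_eq A P) rmorphD rmorphM !hornerE.
  by rewrite (rootP rP) mulr0 add0r.
rewrite /dvdp; apply/idP/eqP => [rAP|->]; last by rewrite rmorph0 root0.
apply/eqP/negPn/negP => AP0.
have : (n <= size (A %% P)%R)%N by apply: n_min; apply/asboolP; exists (A %% P).
by rewrite leqNgt -sP ltn_modp P0.
Qed.

Lemma expr_fixed_pow (L : finFieldType) q r (x : L) :
  x ^+ q = x -> x ^+ (q ^ r) = x.
Proof. by move=> xq; elim: r => // r IH; rewrite expnS exprM xq. Qed.

Lemma size_XnsubX (K : fieldType) n : (1 < n)%N ->
  size ('X^n - 'X : {poly K}) = n.+1.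
Proof.
by move=> n1; rewrite size_polyDl ?size_polyXn // size_polyN size_polyX ltnS.
Qed.

(** Over [L] the polynomial ['X^#|L| - 'X] is a product of linear factors, so up to a scalar [P] is
    the product of some of them, and of at least one. *)
Lemma root_finField_dvdp_XsubX (L : finFieldType) (P : {poly L}) :
  (1 < size P)%N -> P %| 'X^#|L| - 'X -> exists z, root P z.
Proof.
move=> sP; rewrite finField_genPoly => /dvdp_prod_XsubC [m Pm].
have sz := eqp_size Pm.
rewrite size_prod_XsubC in sz.
case: (mask _ _) Pm sz => [|z t] Pm sz; first by rewrite sz in sP.
by exists z; rewrite (eqp_root Pm) root_prod_XsubC mem_head.
Qed.

(* [K = k(g)]; the minimal polynomial of [g] divides [X^#|L| - X], hence has a
   root [z] in [L], and [A(g) |-> A(z)] is the embedding. *)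
Lemma finField_embedding_over (k : fieldType) (K L : finFieldType)
    (f : {rmorphism k -> K}) (h : {rmorphism k -> L}) r :
  #|L| = (#|K| ^ r)%N ->
  exists phi : K -> L, zmod_morphism phi /\ monoid_morphism phi.
Proof.
move=> cL.
have [g g_gen] := horner_primitive_surj f.
have gL : root (map_poly f ('X^#|L| - 'X)) g.
  rewrite rmorphB /= map_polyXn map_polyX /root !hornerE cL.
  by rewrite expr_fixed_pow ?expf_card ?subrr.
have XX0 : 'X^#|L| - 'X != 0 :> {poly k}.
  by rewrite -size_poly_eq0 size_XnsubX ?card_finNzRing_gt1.
have [P P0 Pgen] := annihilator_generator XX0 gL.
have [z rz] : exists z, root (map_poly h P) z.
  apply: root_finField_dvdp_XsubX.
    (* A constant [P] would divide 1, and then [g] would be a root of 1. *)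
    rewrite size_map_poly ltnNge; apply/negP => /size1_polyC Pc.
    have : ~~ root (map_poly f 1) g by rewrite rmorph1 root1.
    by rewrite Pgen Pc dvdp1 size_polyC -polyC_eq0 -Pc P0.
  have : P %| 'X^#|L| - 'X by rewrite -Pgen.
  by rewrite -(dvdp_map h) rmorphB /= map_polyXn map_polyX.
(* The value at [z] depends only on the value at [g]. Hence an arbitrary choice of representatives
   [lift] still yields a ring morphism. *)
have key A B : (map_poly f A).[g] = (map_poly f B).[g] ->
    (map_poly h A).[z] = (map_poly h B).[z].
  move=> AB; apply/eqP; rewrite -subr_eq0 -hornerN -hornerD -rmorphB.
  rewrite /=; have : P %| A - B.
    by rewrite -Pgen rmorphB /root !hornerE AB subrr.
  rewrite -(dvdp_map h) => /dvdpP [Q ->].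
  by rewrite hornerM (rootP rz) mulr0.
have /choice [lift liftP] := g_gen.
exists (fun x => (map_poly h (lift x)).[z]); split; last split.
- move=> x y; rewrite -hornerN -hornerD -rmorphB; apply: key.
  by rewrite rmorphB !hornerE -!liftP.
- have -> : 1 = (map_poly h 1).[z] by rewrite rmorph1 hornerE.
  by apply: key; rewrite -liftP rmorph1 hornerE.
- move=> x y; rewrite -hornerM -rmorphM; apply: key.
  by rewrite rmorphM !hornerE -!liftP.
Qed.

(** Both fields have characteristic [p], so the prime field serves as the common base field. *)
Lemma finField_embedding (K L : finFieldType) p k r :
  prime p -> #|K| = (p ^ k)%N -> #|L| = (#|K| ^ r)%N ->
  exists phi : K -> L, zmod_morphism phi /\ monoid_morphism phi.
Proof.
move=> pr_p cK cL.
have pK := card_finPcharP cK pr_p.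
have pL : p \in [pchar L] by apply: card_finPcharP pr_p; rewrite cL cK -expnM.
exact: (@finField_embedding_over 'F_p (pPrimeCharType pK) (pPrimeCharType pL)
  (GRing.in_alg (pPrimeCharType pK)) (GRing.in_alg (pPrimeCharType pL)) r).
Qed.

(* Coordinates with respect to the power basis of a primitive element. *)
Lemma finField_coordinates (K L : finFieldType) (phi : {rmorphism K -> L}) r :
  #|L| = (#|K| ^ r)%N ->
  exists S : 'rV[K]_r -> L,
    bijective S /\ forall a v w, S (a *: v + w) = phi a * S v + S w.
Proof.
move=> cL.
have [g g_gen] := horner_primitive_surj phi.
have gL : root (map_poly phi ('X^#|L| - 'X)) g.
  by rewrite rmorphB /= map_polyXn map_polyX /root !hornerE expf_card subrr.
have XX0 : 'X^#|L| - 'X != 0 :> {poly K}.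
  by rewrite -size_poly_eq0 size_XnsubX ?card_finNzRing_gt1.
have [P P0 Pgen] := annihilator_generator XX0 gL.
pose S n (v : 'rV[K]_n) := (map_poly phi (rVpoly v)).[g].
have Slin n a (v w : 'rV_n) : S n (a *: v + w) = phi a * S n v + S n w.
  by rewrite /S linearP /= rmorphD /= map_polyZ !hornerE.
set n := (size P).-1.
have sP : size P = n.+1 by rewrite prednK // size_poly_gt0.
(* A polynomial of size at most [n] divisible by [P], whose size is [n.+1], vanishes. *)
have S_inj : injective (S n).
  move=> v w /eqP; rewrite -subr_eq0 -hornerN -hornerD -rmorphB -raddfB.
  rewrite -/(root _ g) Pgen => dvd; apply/eqP; rewrite -subr_eq0.
  suff /eqP E : rVpoly (v - w) == 0 by rewrite -[v - w]rVpolyK E linear0.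
  apply/negPn/negP => n0; have := dvdp_leq n0 dvd.
  by rewrite sP leqNgt ltnS size_poly.
have S_surj x : exists v, S n v = x.
  have [A ->] := g_gen x; exists (poly_rV (A %% P)).
  rewrite /S poly_rV_K; last by rewrite -ltnS -sP ltn_modp.
  have : P %| A - A %% P by rewrite {1}(divp_eq A P) addrK dvdp_mull.
  by rewrite -Pgen rmorphB /root !hornerE subr_eq0 => /eqP.
have S_bij : bijective (S n).
  have /choice [T TP] := S_surj.
  by exists T => // v; apply: S_inj.
(* The degree [n] of [P] is found by counting: [#|K| ^ n = #|L| = #|K| ^ r]. *)
suff <- : n = r by exists (S n).
have := bij_eq_card S_bij; rewrite card_mx mul1n cL => /eqP.
by rewrite eqn_exp2l ?card_finNzRing_gt1 // => /eqP.
Qed.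

(** * Volumes of boxes and digit expansions *)

Lemma lebesgueN_set0 (R : realType) s : @lebesgueN R s set0 = 0%E.
Proof.
elim: s => [|s IH] /=; first by rewrite diracE in_set0.
by rewrite (eq_integral (cst 0%E)) ?integral0.
Qed.

(** The section of the box at [x] is the box in the remaining coordinates if [x] lies in the first
    interval, and empty otherwise; the outer integral is thus that of a constant over an
    interval. *)
Lemma lebesgueN_box (R : realType) s (lo hi : 'I_s -> R) :
  (forall i, lo i <= hi i) ->
  lebesgueN [set x : s.-tuple R | forall i, lo i <= tnth x i < hi i] =
  (\prod_i (hi i - lo i))%:E.
Proof.
elim: s lo hi => [|s IH] lo hi lohi.
  by rewrite /= big_ord0 diracE mem_set // => -[].
pose lo' i := lo (lift ord0 i); pose hi' i := hi (lift ord0 i).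
rewrite big_ord_recl /=.
pose c := \prod_i (hi' i - lo' i).
transitivity (\int[lebesgue_measure]_x
    ((cst c%:E) \_ `[lo ord0, hi ord0[%classic) x)%E.
  apply: eq_integral => x _; rewrite patchE; case: ifPn => [|/negP] xI.
    rewrite -IH; last by move=> i; exact: lohi.
    congr lebesgueN; apply/seteqP; split => t /= tP i.
      by have := tP (lift ord0 i); rewrite tnthS.
    case: (unliftP ord0 i) => [j ->|->]; first by rewrite tnthS; exact: tP.
    by rewrite tnth0; move: xI; rewrite inE /= in_itv.
  rewrite -[RHS](lebesgueN_set0 R s); congr lebesgueN.
  apply/seteqP; split => // t /= /(_ ord0); rewrite tnth0 => xI'.
  by apply: xI; rewrite inE /= in_itv.
rewrite -integral_mkcond integral_cst //= lebesgue_measure_itv /= lte_fin.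
rewrite /c -/(lo' _); case: ltP => [_|le]; first by rewrite -EFinB -EFinM mulrC.
rewrite mule0 (_ : hi ord0 = lo ord0) ?subrr ?mul0r //.
by apply/le_anti; rewrite le lohi.
Qed.

Lemma lebesgueN_elementary (R : realType) b s (d a : 'I_s -> nat) :
  (0 < b)%N ->
  lebesgueN (@elementary_interval R b s d a) = ((b ^ \sum_i d i)%:R^-1)%:E.
Proof.
move=> b0; rewrite /elementary_interval lebesgueN_box; last first.
  by move=> i; rewrite ler_pM2r ?ler_nat // invr_gt0 ltr0n expn_gt0 b0.
rewrite expn_sum natr_prod -prodfV; congr (_%:E); apply: eq_bigr => i _.
by rewrite -mulrBl -natrB ?leqnSn // subSnn mul1r.
Qed.

(** The leading digit is [k 0], so this is the numerator over [b ^ m] of the fraction with digits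
    [k 0, k 1, ...], and dropping its last digits is an integer division. *)
Fixpoint horner_digits (b : nat) (k : nat -> nat) (m : nat) : nat :=
  if m is m'.+1 then (horner_digits b k m' * b + k m')%N else 0%N.

Lemma horner_digits_divn b k d m : (0 < b)%N -> (forall j, k j < b)%N ->
  (d <= m)%N -> (horner_digits b k m %/ b ^ (m - d))%N = horner_digits b k d.
Proof.
move=> b0 kb dm; rewrite -{1}(subnKC dm); elim: (m - d)%N => [|c IH].
  by rewrite addn0 divn1.
by rewrite addnS expnS divnMA /= divnMDl // (divn_small (kb _)) addn0.
Qed.

Lemma horner_digits_lt b k m : (forall j, k j < b)%N ->
  (horner_digits b k m < b ^ m)%N.
Proof.
move=> kb; elim: m => //= m IH; rewrite expnSr.
apply: (@leq_trans ((horner_digits b k m).+1 * b)).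
  by rewrite mulSn addnC ltn_add2r.
by rewrite leq_mul2r IH orbT.
Qed.

Lemma horner_digits_inj b k k' m :
  (forall j, k j < b)%N -> (forall j, k' j < b)%N ->
  horner_digits b k m = horner_digits b k' m <->
  forall j, (j < m)%N -> k j = k' j.
Proof.
move=> kb k'b; have b0 : (0 < b)%N by apply: leq_ltn_trans (kb 0%N).
elim: m => [|m IH] //=; split=> [E|E].
  have /IH eq_lt : horner_digits b k m = horner_digits b k' m.
    have := congr1 (divn^~ b) E.
    by rewrite !divnMDl // !divn_small // !addn0.
  move=> j; rewrite ltnS leq_eqVlt => /predU1P [->|/eq_lt //].
  by have := congr1 (modn^~ b) E; rewrite !modnMDl !modn_small.
by rewrite E // (IH.2 _) // => j jm; apply: E; exact: ltnW.
Qed.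

Lemma horner_digits_surj b m a : (0 < b)%N -> (a < b ^ m)%N ->
  exists2 k, (forall j, k j < b)%N & a = horner_digits b k m.
Proof.
move=> b0; elim: m a => [|m IH] a; first by case: a => // _; exists (fun=> 0%N).
rewrite expnSr -ltn_divLR // => /IH [k kb ak].
exists (fun j => if j == m then a %% b else k j)%N => [j|/=].
  by case: ifP; rewrite ?ltn_pmod.
rewrite eqxx {1}(divn_eq a b) ak; congr (_ * _ + _)%N.
apply/horner_digits_inj => // j; first by case: ifP; rewrite ?ltn_pmod.
by move=> jm; rewrite ltn_eqF.
Qed.

Lemma sum_digits_horner (R : realType) b (k : nat -> nat) m : (0 < b)%N ->
  \sum_(j < m) (k j)%:R / (b ^ j.+1)%:R =
  (horner_digits b k m)%:R / (b ^ m)%:R :> R.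
Proof.
move=> b0; elim: m => [|m IH]; first by rewrite big_ord0 mul0r.
rewrite big_ord_recr /= IH natrD mulrDl; congr (_ + _).
by rewrite expnSr !natrM invfM mulrACA divff ?mulr1 // pnatr_eq0 -lt0n.
Qed.

(** Clearing denominators turns membership in an elementary interval into a statement about the
    leading [d] digits of [N]. *)
Lemma natr_div_itv (R : realType) b d m N a : (0 < b)%N -> (d <= m)%N ->
  (a%:R / (b ^ d)%:R <= (N%:R : R) / (b ^ m)%:R < a.+1%:R / (b ^ d)%:R) =
  (N %/ b ^ (m - d) == a)%N.
Proof.
move=> b0 dm; have bp n : 0 < (b ^ n)%:R :> R by rewrite ltr0n expn_gt0 b0.
rewrite -{1 2}(subnKC dm) expnD natrM invfM mulrA ![_ / (b ^ d)%:R * _]mulrAC.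
rewrite ler_pM2r ?invr_gt0 // ltr_pM2r ?invr_gt0 //.
rewrite ler_pdivlMr // ltr_pdivrMr // -!natrM ler_nat ltr_nat.
have bc : (0 < b ^ (m - d))%N by rewrite expn_gt0 b0.
by rewrite -leq_divRL // -ltn_divLR // ltnS andbC -eqn_leq.
Qed.

(** * The net property as solvability of linear systems *)

(** Translation by a preimage of [w - y] carries the fibre over [y] onto the fibre over [w], so [V]
    splits into [#|F| ^ #|I|] fibres of equal size. *)
Lemma card_zmod_morphism_fiber (V : finZmodType) (I : finType)
    (F : finZmodType) (L : V -> {ffun I -> F}) (y : {ffun I -> F}) :
  zmod_morphism L -> (forall w, exists x, L x = w) ->
  (#|[pred x | L x == y]| * #|F| ^ #|I| = #|V|)%N.
Proof.
move=> LB Lsurj.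
have fibers w : #|[pred x | L x == y]| = #|[pred x | L x == w]|.
  have [z Lz] := Lsurj (w - y).
  have LN x : L (- x) = - L x.
    by rewrite -[- x]sub0r LB -{1}(subrr x) LB subrr sub0r.
  rewrite -!sum1_card [RHS](reindex (fun x => x + z)); last first.
    by apply: onW_bij; exists (fun x => x - z) => x; rewrite ?addrK ?subrK.
  apply: eq_bigl => x; rewrite !inE -[in RHS](opprK z) LB LN opprK Lz.
  by rewrite -[LHS](inj_eq (addIr (w - y))) [y + _]addrC subrK.
rewrite -card_ffun -[RHS]sum1_card (partition_big L xpredT) //= mulnC.
rewrite -sum_nat_const.
by apply: eq_bigr => w _; rewrite (fibers w) -sum1_card.
Qed.

Lemma digit_inj Q (Q0 : (0 < Q)%N) m n n' :
  (n < Q ^ m)%N -> (n' < Q ^ m)%N ->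
  (forall k, (k < m)%N -> digit Q0 n k = digit Q0 n' k) -> n = n'.
Proof.
elim: m n n' => [|m IH] n n'.
  by rewrite expn0 !ltnS !leqn0 => /eqP -> /eqP ->.
rewrite !expnSr -!ltn_divLR // => nQ n'Q E.
rewrite (divn_eq n Q) (divn_eq n' Q) (IH _ _ nQ n'Q) => [|k km].
  by have := congr1 val (E 0%N isT); rewrite /= !divn1 => ->.
by apply/val_inj; have := congr1 val (E k.+1 km); rewrite /= expnS !divnMA.
Qed.

Section DigitalNet.
Variables (R : realType) (F : finFieldType) (m s : nat).
Variable D : digital_generator F m s.
Local Notation Q := #|F|.

Let Q_gt0 : (0 < Q)%N := card_finField_gt0 F.
Let Q_gt1 : (1 < Q)%N := card_finNzRing_gt1 F.

Definition input_vector (n : nat) : 'cV[F]_m :=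
  \col_k gen_eta D k (digit (card_finField_gt0 F) n k).

Lemma input_vector_bij : bijective (fun n : 'I_(Q ^ m) => input_vector n).
Proof.
apply: inj_card_bij; last by rewrite card_mx muln1 card_ord.
move=> n n' /colP E; apply: ord_inj.
apply: (@digit_inj Q Q_gt0 m _ _ (ltn_ord n) (ltn_ord n')) => k km.
have := E (Ordinal km); rewrite !mxE.
exact: (bij_inj (gen_eta_bij D (Ordinal km))).
Qed.

(** The default 0 from position [m] on is a legal digit, so the bound by [Q] holds at every
    position. *)
Definition digit_word (w : 'I_s -> 'I_m -> F) (i : 'I_s) (j : nat) : nat :=
  oapp (fun j' : 'I_m => val (gen_kappa D i j' (w i j'))) 0%N (insub j).

Lemma digit_word_lt w i j : (digit_word w i j < Q)%N.
Proof. by rewrite /digit_word; case: insub => [j'|] /=; [exact: ltn_ord|]. Qed.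

Lemma digit_wordE w i (j : 'I_m) : digit_word w i j = gen_kappa D i j (w i j).
Proof. by rewrite /digit_word valK. Qed.

Definition digit_box (w : 'I_s -> 'I_m -> F) (d : 'I_s -> nat) (i : 'I_s) :
    nat :=
  horner_digits Q (digit_word w i) (d i).

Definition solves (d : 'I_s -> nat) (w : 'I_s -> 'I_m -> F) (x : 'cV[F]_m) :
    bool :=
  [forall i, forall j : 'I_m, (j < d i)%N ==> ((gen_mx D i *m x) j 0 == w i j)].

(** This is linear independence of the selected rows of all the matrices together, in the form that
    descends to the subfield. *)
Definition onto (d : 'I_s -> nat) : Prop :=
  forall w, exists x, solves d w x.

Lemma tnth_digital_points (n : 'I_(Q ^ m)) i :
  tnth (digital_points R D n) i =
  (horner_digits Q (digit_word (fun i j => digital_output D n i j ord0) i) m)%:R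
    / (Q ^ m)%:R.
Proof.
rewrite tnth_mktuple -sum_digits_horner //; apply: eq_bigr => j _.
by rewrite digit_wordE.
Qed.

Lemma digital_points_itv (n : 'I_(Q ^ m)) i :
  0 <= tnth (digital_points R D n) i < 1.
Proof.
rewrite tnth_digital_points divr_ge0 ?ler0n //=.
rewrite ltr_pdivrMr ?ltr0n ?expn_gt0 ?Q_gt0 //.
by rewrite mul1r ltr_nat horner_digits_lt // => j; exact: digit_word_lt.
Qed.

(** The box fixes the leading [d i] digits of coordinate [i], and injectivity of the [gen_kappa]
    turns equal digits into equal field elements. *)
Lemma mem_digit_box (d : 'I_s -> nat) w (n : 'I_(Q ^ m)) :
  (forall i, (d i <= m)%N) ->
  (digital_points R D n \in elementary_interval Q d (digit_box w d)) =
  solves d w (input_vector n).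
Proof.
move=> dm; apply/idP/idP; rewrite inE /elementary_interval /=.
  move=> nJ; apply/forallP => i; apply/forallP => j; apply/implyP => jd.
  have := nJ i; rewrite tnth_digital_points natr_div_itv //.
  rewrite horner_digits_divn //; last exact: digit_word_lt.
  move/eqP/horner_digits_inj => E.
  have := E (digit_word_lt _ _) (digit_word_lt _ _) j jd; rewrite !digit_wordE.
  by move=> /val_inj/(bij_inj (gen_kappa_bij D i j)) ->.
move=> /forallP nw i.
rewrite tnth_digital_points natr_div_itv //.
rewrite horner_digits_divn //; last exact: digit_word_lt.
apply/eqP/horner_digits_inj => [||j jd]; try exact: digit_word_lt.
have jm := leq_trans jd (dm i).
rewrite -[j]/(val (Ordinal jm)) !digit_wordE.
by have /forallP/(_ (Ordinal jm))/implyP/(_ jd)/eqP -> := nw i.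
Qed.

Lemma digit_box_surj (d a : 'I_s -> nat) :
  (forall i, d i <= m)%N -> (forall i, a i < Q ^ d i)%N ->
  exists w, forall i, a i = digit_box w d i.
Proof.
move=> dm aQ.
have /choice [k kP] i : exists k : nat -> nat,
    (forall j, k j < Q)%N /\ a i = horner_digits Q k (d i).
  by have [k kQ ->] := horner_digits_surj Q_gt0 (aQ i); exists k.
have /choice [w wP] (ij : 'I_s * 'I_m) : exists x : F,
    gen_kappa D ij.1 ij.2 x = k ij.1 ij.2 :> nat.
  have [g _ gK] := gen_kappa_bij D ij.1 ij.2.
  by exists (g (Ordinal ((kP ij.1).1 ij.2))); rewrite gK.
exists (fun i j => w (i, j)) => i; rewrite (kP i).2.
apply/horner_digits_inj => [||j jd]; [exact: (kP i).1|exact: digit_word_lt|].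
rewrite -[j]/(val (Ordinal (leq_trans jd (dm i)))) digit_wordE.
exact/esym/(wP (i, _)).
Qed.

Lemma card_digit_box (d : 'I_s -> nat) w :
  (forall i, (d i <= m)%N) ->
  #|[pred n | digital_points R D n \in elementary_interval Q d (digit_box w d)]|
  = #|solves d w|.
Proof.
move=> dm; rewrite -[LHS]sum1_card -[RHS]sum1_card.
rewrite [RHS](reindex (fun n : 'I_(Q ^ m) => input_vector n)); last first.
  exact/onW_bij/input_vector_bij.
by apply: eq_bigl => n; rewrite inE mem_digit_box.
Qed.

Lemma card_solves (d : 'I_s -> nat) w :
  (forall i, (d i <= m)%N) -> onto d ->
  (#|solves d w| * Q ^ (\sum_i d i) = Q ^ m)%N.
Proof.
move=> dm dD.
(* [I] indexes the equations of the system; there are [\sum_i d i] of them because each [d i] is at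
   most [m]. *)
pose I := {p : 'I_s * 'I_m | (p.2 < d p.1)%N}.
pose rhs (v : 'I_s -> 'I_m -> F) : {ffun I -> F} :=
  [ffun p => v (val p).1 (val p).2].
pose L (x : 'cV[F]_m) := rhs (fun i j => (gen_mx D i *m x) j 0).
have solvesE v x : solves d v x = (L x == rhs v).
  apply/forallP/eqP => [xv|/ffunP xv i].
    apply/ffunP => -[[i j] /= jd]; rewrite !ffunE /=.
    by have /forallP/(_ j)/implyP/(_ jd)/eqP := xv i.
  apply/forallP => j; apply/implyP => jd.
  by have := xv (exist _ (i, j) jd); rewrite !ffunE /= => ->.
have LB : zmod_morphism L.
  by move=> x y; apply/ffunP => p; rewrite !ffunE mulmxBr !mxE.
have Lsurj y : exists x, L x = y.
  (* The right-hand side is extended by 0 to the positions that carry no equation. *)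
  have [x] := dD (fun i j => oapp y 0 (insub (i, j))).
  rewrite solvesE => /eqP xv; exists x; rewrite xv.
  by apply/ffunP => p; rewrite ffunE -surjective_pairing valK.
have -> : #|solves d w| = #|[pred x | L x == rhs w]|.
  by apply: eq_card => x; rewrite !inE; exact: solvesE.
have cI : (\sum_i d i)%N = #|{: I}|.
  rewrite card_sig -sum1_card.
  rewrite -(pair_big_dep xpredT (fun i (j : 'I_m) => (j < d i)%N)
    (fun _ _ => 1%N)) /=.
  apply: eq_bigr => i _.
  by rewrite -(big_ord_widen _ (fun=> 1%N)) // sum1_card card_ord.
have := card_zmod_morphism_fiber (rhs w) LB Lsurj.
by rewrite -cI card_mx muln1.
Qed.

Lemma le_lebesgueN_elementary (d a : 'I_s -> nat) u : (u <= m)%N ->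
  ((Q%:R ^ (u%:Z - m%:Z) : R)%:E <= lebesgueN (elementary_interval Q d a))%E =
  (u + \sum_i d i <= m)%N.
Proof.
move=> um; rewrite lebesgueN_elementary // lee_fin.
have -> : (u%:Z - m%:Z = - (m - u)%N%:Z)%R by rewrite -subzn // opprB.
rewrite -exprnN -natrX lef_pV2 ?posrE ?ltr0n ?expn_gt0 ?Q_gt0 //.
by rewrite ler_nat leq_exp2l // leq_subRL.
Qed.

(** The box that encodes [w] must contain a positive number of points, and the input vector of each
    of them solves the system. *)
Lemma is_net_onto u (e d : 'I_s -> nat) :
  is_net u e (digital_points R D) -> (forall i, e i %| d i)%N ->
  (u + \sum_i d i <= m)%N -> onto d.
Proof.
move=> [um _ net] ed dm w.
have d_le i : (d i <= m)%N.
  by apply: leq_trans dm; rewrite (bigD1 i) //= addnCA leq_addr.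
have boxQ i : (digit_box w d i < Q ^ d i)%N.
  by apply: horner_digits_lt => j; exact: digit_word_lt.
have := net _ _ boxQ ed; cbv zeta.
rewrite le_lebesgueN_elementary // => /(_ dm).
rewrite lebesgueN_elementary // card_digit_box // -EFinM => -[] cnt.
have : (0 < #|solves d w|)%N.
  by rewrite -(ltr0n R) cnt divr_gt0 // ltr0n expn_gt0 Q_gt0.
by case/card_gt0P => x; exists x.
Qed.

(** Every admissible box is a digit box, and the fibre count gives exactly [Q ^ m] divided by
    [Q ^ \sum_i d i] points in it. *)
Lemma onto_is_net u (e : 'I_s -> nat) : (u <= m)%N ->
  (forall d, (forall i, e i %| d i)%N -> (u + \sum_i d i <= m)%N -> onto d) ->
  is_net u e (digital_points R D).
Proof.
move=> um dD; split=> // [|d a aQ ed J]; first exact: digital_points_itv.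
rewrite {}/J le_lebesgueN_elementary // => dm.
have d_le i : (d i <= m)%N.
  by apply: leq_trans dm; rewrite (bigD1 i) //= addnCA leq_addr.
have [w aw] := digit_box_surj d_le aQ.
rewrite lebesgueN_elementary // -EFinM; congr (_%:E).
rewrite (_ : a = digit_box w d); last exact/funext.
rewrite card_digit_box // -(card_solves w d_le (dD d ed dm)) natrM mulfK //.
by rewrite pnatr_eq0 -lt0n expn_gt0 Q_gt0.
Qed.

End DigitalNet.

(** * The base change *)

Lemma linear_form_row (K : fieldType) n (g : 'cV[K]_n -> K) :
  (forall a x y, g (a *: x + y) = a * g x + g y) ->
  forall x, g x = \sum_k g (delta_mx k 0) * x k 0.
Proof.
move=> g_lin x.
have g0 : g 0 = 0.
  by have := g_lin (-1) 0 0; rewrite scaler0 addr0 mulN1r addNr.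
rewrite {1}(matrix_sum_delta x).
elim/big_rec2: _ => // k y1 y2 _ <-.
by rewrite big_ord1 g_lin mulrC.
Qed.

Section BaseChange.
Variables (K L : finFieldType) (phi : {rmorphism K -> L}) (r m s : nat).
Variables (S : 'rV[K]_r -> L) (T : L -> 'rV[K]_r).
Hypotheses (ST : cancel S T) (TS : cancel T S).
Hypothesis S_lin : forall a v w, S (a *: v + w) = phi a * S v + S w.
Hypothesis r_gt0 : (0 < r)%N.
Variable D : digital_generator L m s.

Lemma coord_semilinear a x y : T (phi a * x + y) = a *: T x + T y.
Proof. by rewrite -{1}(TS x) -{1}(TS y) -S_lin ST. Qed.

(** The identification of inputs over [K] with inputs over [L], by which the new net reuses the old
    matrices. *)
Definition pack_vector (x : 'cV[K]_(r * m)) : 'cV[L]_m :=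
  \col_k S (col k (vec_mx x^T : 'M[K]_(r, m)))^T.

Definition unpack_vector (y : 'cV[L]_m) : 'cV[K]_(r * m) :=
  (mxvec (\matrix_(l < r, k < m) T (y k 0) 0 l))^T.

Lemma unpack_vectorK : cancel unpack_vector pack_vector.
Proof.
move=> y; apply/colP => k; rewrite mxE trmxK mxvecK -[RHS]TS; congr S.
by apply/rowP => l; rewrite !mxE.
Qed.

Lemma pack_vector_semilinear a x y :
  pack_vector (a *: x + y) = phi a *: pack_vector x + pack_vector y.
Proof.
apply/colP => k; rewrite !mxE -S_lin; congr S.
by rewrite !linearP.
Qed.

Definition block_of (c : 'I_(r * s)) : 'I_s := Ordinal (block_index_lt c).
Definition offset_of (c : 'I_(r * s)) : 'I_r := Ordinal (ltn_pmod c r_gt0).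

Lemma block_offset_lt (i : 'I_s) (l : 'I_r) : (i * r + l < r * s)%N.
Proof.
rewrite [ltnRHS]mulnC; apply: (@leq_trans (i.+1 * r)).
  by rewrite mulSn addnC ltn_add2r.
by rewrite leq_mul2r ltn_ord orbT.
Qed.

Definition block_offset i l : 'I_(r * s) := Ordinal (block_offset_lt i l).

Lemma block_offsetK c : block_offset (block_of c) (offset_of c) = c.
Proof. by apply: val_inj; rewrite /= -divn_eq. Qed.

(** One coordinate of an output entry over [L]; the default 0 gives the zero rows from [m] on. *)
Definition expanded_row (c : 'I_(r * s)) (j : nat) (x : 'cV[K]_(r * m)) : K :=
  oapp (fun j' : 'I_m =>
    T ((gen_mx D (block_of c) *m pack_vector x) j' 0) 0 (offset_of c))
    0 (insub j).

Lemma expanded_row_linear c j a x y :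
  expanded_row c j (a *: x + y) = a * expanded_row c j x + expanded_row c j y.
Proof.
rewrite /expanded_row; case: insub => [j'|] /=; last by rewrite mulr0 addr0.
by rewrite pack_vector_semilinear mulmxDr -scalemxAr !mxE coord_semilinear !mxE.
Qed.

(** Solvability is decided by the matrices alone, so the standard enumeration of [K] supplies all
    the bijections. *)
Definition base_change : digital_generator K (r * m) (r * s) :=
  @DigitalGenerator K (r * m) (r * s)
    (fun c => \matrix_(j, k) expanded_row c j (delta_mx k 0))
    (fun _ => enum_val) (fun _ _ => enum_rank)
    (fun _ => enum_val_bij _) (fun _ _ => enum_rank_bij _).

Lemma base_changeE c x j : (gen_mx base_change c *m x) j 0 = expanded_row c j x.
Proof.
rewrite (linear_form_row (expanded_row_linear c j)) mxE.
by apply: eq_bigr => k _; rewrite mxE.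
Qed.

Definition block_max (d : 'I_(r * s) -> nat) (i : 'I_s) : nat :=
  \max_(c | block_of c == i) d c.

Lemma onto_base_change (d : 'I_(r * s) -> nat) :
  (forall i, block_max d i <= m)%N -> onto D (block_max d) ->
  onto base_change d.
Proof.
move=> dm dD w.
have m_le : (m <= r * m)%N by rewrite leq_pmull.
(* The [r] values of [w] at position [j] in block [i] are glued into one element of [L]. Where [j]
   is at least the exponent of a coordinate, this imposes a surplus equation, still within reach
   because [block_max] rows are solvable. *)
have [y /forallP yP] := dD (fun i j =>
  S (\row_l w (block_offset i l) (widen_ord m_le j))).
exists (unpack_vector y); apply/forallP => c; apply/forallP => j.
apply/implyP => jd; rewrite base_changeE /expanded_row.
have j_lt : (j < block_max d (block_of c))%N.
  exact: (leq_trans jd (leq_bigmax_cond _ _)).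
pose j' := Ordinal (leq_trans j_lt (dm _)).
rewrite -[nat_of_ord j]/(val j') valK /= unpack_vectorK.
have /forallP/(_ j')/implyP/(_ j_lt)/eqP -> := yP (block_of c).
rewrite ST mxE block_offsetK; apply/eqP; congr (w c _); exact: val_inj.
Qed.

Lemma sum_block_max (d : 'I_(r * s) -> nat) :
  (\sum_i block_max d i <= \sum_c d c)%N.
Proof.
rewrite [leqRHS](partition_big block_of xpredT) //=; apply: leq_sum => i _.
by apply/bigmax_leqP => c ci; rewrite (bigD1 c) //= leq_addr.
Qed.

(** All exponents in block [i] are multiples of the same [e i], and a maximum of multiples is one of
    them, or 0. *)
Lemma dvdn_block_max (e : 'I_s -> nat) (d : 'I_(r * s) -> nat) i :
  (forall c, repeat_each e c %| d c)%N -> (e i %| block_max d i)%N.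
Proof.
move=> ed; apply: (big_ind (fun n => e i %| n)%N) => // [x y xe ye|c /eqP <-].
  by rewrite /maxn; case: ifP.
exact: ed.
Qed.

Lemma is_net_base_change (R : realType) u e :
  is_net u e (digital_points R D) ->
  is_net ((r - 1) * m + u) (repeat_each (r := r) e)
    (digital_points R base_change).
Proof.
move=> netD; have [um _ _] := netD.
(* This explains the new parameter: [r * m] exceeds [(r - 1) * m + u] by exactly [m - u], so the
   total number of prescribed digits has the same bound as before. *)
have rm : (r * m = (r - 1) * m + m)%N by rewrite -mulSnr subn1 prednK.
apply: onto_is_net => [|d ed]; first by rewrite rm leq_add2l.
rewrite [leqRHS]rm -addnA leq_add2l => dm.
have dmax : (u + \sum_i block_max d i <= m)%N.
  exact: leq_trans (leq_add (leqnn u) (sum_block_max d)) dm.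
apply: onto_base_change => [i|].
  by apply: leq_trans dmax; rewrite (bigD1 i) //= addnCA leq_addr.
by apply: (is_net_onto netD) dmax => i; exact: dvdn_block_max.
Qed.
End BaseChange.

Theorem theorem2 (R : realType) (q m s u r : nat)
  (hq : exists p k : nat, [/\ prime p, (0 < k)%N & q = (p ^ k)%N])
  (hm : (1 <= m)%N) (hs : (1 <= s)%N) (hr : (1 <= r)%N)
  (e : 'I_s -> nat) (he : forall i, (0 < e i)%N)
  (Fq Fqr : finFieldType) (hFq : #|Fq| = q) (hFqr : #|Fqr| = (q ^ r)%N) :
  digital_net_exists R Fqr u m e ->
  digital_net_exists R Fq ((r - 1) * m + u)%N (r * m)%N (@repeat_each r s e).
Proof.
case=> D netD; have [p [k [pr_p _ qE]]] := hq.
rewrite -{}hFq in hFqr qE.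
have [f [fB fM]] := finField_embedding pr_p qE hFqr.
pose phi : {rmorphism Fq -> Fqr} :=
  HB.pack f (GRing.isZmodMorphism.Build _ _ f fB)
    (GRing.isMonoidMorphism.Build _ _ f fM).
have [S [[T ST TS] S_lin]] := finField_coordinates phi hFqr.
exists (base_change S T hr D); exact: (is_net_base_change ST TS).
Qed.
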